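(* If $X$ and $Y$ are well-filtered spaces, then the product space $X\times Y$ (with the product topology) is well-filtered.
   Context: For a topological space $X$ and $A\subseteq X$, the saturation of $A$ is $sat(A)=\bigcap\{U : U \text{ open in } X,\ A\subseteq U\}$, and $A$ is saturated if $A=sat(A)$. Compact means every open cover has a finite subcover (no separation axiom is assumed). A nonempty family $\mathcal F$ of saturated compact subsets of $X$ is filtered if for any $F_1,F_2\in\mathcal F$ there is $F_3\in\mathcal F$ with $F_3\subseteq F_1\cap F_2$. A $T_0$ space $X$ is well-filtered if for every open set $U\subseteq X$ and every filtered family $\mathcal F$ of saturated compact subsets of $X$, $\bigcap\mathcal F\subseteq U$ implies $F\subseteq U$ for some $F\in\mathcal F$. *)

(* Defs.v *)
From mathcomp Require Import all_boot.
From mathcomp Require Import all_classical topology.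
Set Implicit Arguments.
Unset Strict Implicit.
Unset Printing Implicit Defensive.
Local Open Scope classical_set_scope.

Section WellFiltered.
Context {X : topologicalType}.

Definition sat (A : set X) : set X :=
  \bigcap_(U in [set U : set X | open U /\ A `<=` U]) U.

Definition saturated (A : set X) : Prop := A = sat A.

(* Compactness is [cover_compact] (open covers) rather than the filter-based
   [compact]: the library proves them equal only for pointed spaces, while
   spaces here may be empty. *)
Definition saturated_compact (A : set X) : Prop :=
  saturated A /\ cover_compact A.

Definition filtered_family (F : set (set X)) : Prop :=
  [/\ F !=set0,
      F `<=` saturated_compact
    & forall F1 F2 : set X, F F1 -> F F2 ->
        exists2 F3 : set X, F F3 & F3 `<=` F1 `&` F2].

End WellFiltered.

Definition well_filtered (X : topologicalType) : Prop :=
  kolmogorov_space X /\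
  forall (U : set X) (F : set (set X)),
    open U -> filtered_family F ->
    \bigcap_(K in F) K `<=` U -> exists2 K : set X, F K & K `<=` U.

(* Main.v *)
Require Import Defs.
From mathcomp Require Import all_boot finmap all_classical topology.

(** Suppose that an open set [U] of [X * Y] contains the intersection of a
filtered family [F] of saturated compact sets, but no member of [F].  By
Zorn's lemma (a topological form of Rudin's lemma), [U] is contained in a
maximal open set [M] containing no member of [F]; in terms of closed sets, the
complement of [M] is minimal among the closed sets meeting every member of
[F].

The sets [sat (fst @` (K `\` M))], for [K] in [F], form a filtered family of
saturated compact sets of [X].  Well-filteredness of [X] and maximality of [M]
provide a point [x] whose open neighbourhoods are exactly the open sets [V]
with [~ fst @^-1` V `<=` M]; in other words, the closure of the projection of
[~` M] is the closure of the point [x].  Let [y] be the point obtained in the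
same way from the second projection.

Every open set containing a member [K] of [F] contains some point of
[K `\` M], hence an open box around that point, and this box contains
[(x, y)]; since [K] is saturated, [(x, y)] belongs to [K].  Therefore [(x, y)]
lies in [U], hence in [M], and some open box [V `*` W] around it is contained
in [M].  By maximality some members of [F] are contained in
[M `|` V `*` setT] and in [M `|` setT `*` W]; a member of [F] contained in
both of them is contained in [M `|` V `*` W = M], which is absurd. *)

Set Implicit Arguments.
Unset Strict Implicit.
Unset Printing Implicit Defensive.

Local Open Scope classical_set_scope.

Section Saturation.
Context {X : topologicalType}.
Implicit Types A B V : set X.

Lemma sub_sat A : A `<=` sat A.
Proof. by move=> x Ax V [_]; exact. Qed.

Lemma sat_sub_open A V : open V -> A `<=` V -> sat A `<=` V.
Proof. by move=> oV AV x; apply. Qed.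

Lemma satS A B : A `<=` B -> sat A `<=` sat B.
Proof. by move=> AB x Ax V [oV BV]; apply: Ax; split=> // z /AB /BV. Qed.

Lemma saturated_sat A : saturated (sat A).
Proof.
apply/seteqP; split=> [|x Ax V [oV AV]]; first exact: sub_sat.
by apply: Ax; split=> //; exact: sat_sub_open.
Qed.

Lemma cover_compact_sat A : cover_compact A -> cover_compact (sat A).
Proof.
move=> cA I D f oD Af.
have [D' D'D AD'] := cA I D f oD (subset_trans (@sub_sat A) Af).
exists D' => //; apply: sat_sub_open => //.
by apply: bigcup_open => i /D'D; rewrite in_setE; exact: oD.
Qed.

Lemma cover_compact_setD A V :
  cover_compact A -> open V -> cover_compact (A `\` V).
Proof.
move=> cA oV I D f oD Af.
have [->|/set0P[z Az]] := eqVneq (A `\` V) set0.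
  by exists fset0 => // i; rewrite inE.
have [i Di _] := Af z Az.
have [||D' D'D AD'] := cA I D (fun i => f i `|` V).
- by move=> j Dj; apply: openU => //; exact: oD.
- move=> x Ax; have [Vx|nVx] := pselect (V x); first by exists i => //; right.
  by have [j Dj fjx] := Af x (conj Ax nVx); exists j => //; left.
by exists D' => // x [/AD'[j D'j [fjx|//]] _]; exists j.
Qed.

Lemma cover_compact_image {Z : topologicalType} (f : Z -> X) (K : set Z) :
  continuous f -> cover_compact K -> cover_compact (f @` K).
Proof.
move=> /continuousP cf cK I D g oD Kg.
have [||D' D'D KD'] := cK I D (fun i => f @^-1` g i).
- by move=> i Di; apply: cf; exact: oD.
- by move=> z Kz; have [|i Di gi] := Kg (f z); [exists z|exists i].
by exists D' => // _ [z /KD'[i D'i giz] <-]; exists i.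
Qed.

End Saturation.

Lemma chain_seq_ub (T : Type) (C : set (set T)) (s : seq (set T)) :
    C !=set0 -> total_on C subset -> {subset s <= C} ->
  exists2 W, C W & forall V, V \in s -> V `<=` W.
Proof.
move=> [W0 CW0] totC; elim: s => [_|A s IHs sC]; first by exists W0.
have [|W CW sW] := IHs; first by move=> V Vs; apply: sC; rewrite inE Vs orbT.
have /set_mem CA : A \in C by apply: sC; rewrite inE eqxx.
have [AW|WA] := totC _ _ CA CW.
- by exists W => // V; rewrite inE => /orP[/eqP->//|]; exact: sW.
- exists A => // V; rewrite inE => /orP[/eqP->//|/sW VW].
  exact: subset_trans WA.
Qed.

(** A topological form of Rudin's lemma, stated for open sets: the last
conclusion expresses the maximality of [M] among the open sets containing no
member of [F]. *)
Lemma exists_maximal_open (Z : topologicalType) (F : set (set Z)) (U : set Z) :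
    F `<=` @cover_compact Z -> open U -> (forall K, F K -> ~ K `<=` U) ->
  exists M, [/\ open M, U `<=` M, forall K, F K -> ~ K `<=` M &
    forall O, open O -> ~ O `<=` M -> exists2 K, F K & K `<=` M `|` O].
Proof.
move=> Fc oU FU.
(* The union of the empty chain is [set0], which need not contain [U]; this is
   why Zorn's lemma is applied to the sets [W] rather than [U `|` W]. *)
pose P (W : set Z) := open W /\ forall K, F K -> ~ K `<=` U `|` W.
have [C CP totC|M0 [[oM0 FM0] maxM0]] := @Zorn_bigcup Z P.
  split; first by apply: bigcup_open => W /CP[].
  move=> K FK KUC.
  have [C0|/set0P C0] := eqVneq C set0.
    by apply: (FU K FK); rewrite C0 bigcup_set0 setU0 in KUC.
  have [||D' D'C KD'] :=
      cover_compact_setD (Fc K FK) oU (D := C) (f := id).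
  - by move=> W /CP[].
  - by move=> z [Kz nUz]; have [] := KUC z Kz.
  have [W CW D'W] := chain_seq_ub C0 totC D'C.
  apply: (CP W CW).2 FK _ => z Kz.
  have [Uz|nUz] := pselect (U z); [by left|right].
  by have [V /D'W] := KD' z (conj Kz nUz); exact.
exists (U `|` M0); split=> //; first exact: openU.
move=> O oO OM; apply: contrapT => noK.
apply: (maxM0 (M0 `|` O)).
  by split=> [z|OM0]; [left|apply: OM => z Oz; right; apply: OM0; right].
split; first exact: openU.
by move=> K FK; rewrite setUA => KO; apply: noK; exists K.
Qed.

(** The point [x] is a generic point of the closure of [f @` (~` M)]. *)
Lemma well_filtered_generic_point (Z X : topologicalType) (f : Z -> X)
    (F : set (set Z)) (M : set Z) :
    continuous f -> well_filtered X -> filtered_family F -> open M ->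
    (forall K, F K -> ~ K `<=` M) ->
    (forall O, open O -> ~ O `<=` M -> exists2 K, F K & K `<=` M `|` O) ->
  exists x, forall V, open V -> V x <-> ~ f @^-1` V `<=` M.
Proof.
move=> cf [_ wfX] [[K0 FK0] Fsc Fdir] oM FM maxM.
pose G := [set sat (f @` (K `\` M)) | K in F].
(* [N] is the largest open set whose preimage is contained in [M]. *)
pose N := \bigcup_(V in [set V | open V /\ f @^-1` V `<=` M]) V.
have oN : open N by apply: bigcup_open => V [].
have NM : f @^-1` N `<=` M by move=> z [V [_ VM]]; exact: VM.
have filtG : filtered_family G.
  split; first by exists (sat (f @` (K0 `\` M))), K0.
  - move=> _ [K FK <-]; split; first exact: saturated_sat.
    apply/cover_compact_sat/cover_compact_image => //.
    by apply: cover_compact_setD => //; exact: (Fsc K FK).2.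
  - move=> _ _ [K1 FK1 <-] [K2 FK2 <-].
    have [K3 FK3 K312] := Fdir _ _ FK1 FK2.
    exists (sat (f @` (K3 `\` M))); first by exists K3.
    by rewrite subsetI; split; apply: satS; apply: image_subset;
      move=> z [/K312[K1z K2z] nMz].
have [x Gx nNx] : exists2 x, (\bigcap_(K in G) K) x & ~ N x.
  apply: contrapT => h.
  have [|_ [K FK <-] KN] := wfX N G oN filtG.
    by move=> x Gx; apply: contrapT => nNx; apply: h; exists x.
  apply: (FM K FK) => z Kz; apply: contrapT => nMz; apply/nMz/NM/KN.
  by apply: sub_sat; exists z.
exists x => V oV; split=> [Vx VM|nVM]; first by apply: nNx; exists V.
have [K FK KMV] := maxM _ ((continuousP f).1 cf V oV) nVM.
apply: (sat_sub_open oV _ (Gx _ (ex_intro2 _ _ K FK erefl))).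
by move=> _ [z [/KMV[//|Vz] _] <-].
Qed.

Lemma open_box (X Y : topologicalType) (O : set (X * Y)) (p : X * Y) :
  open O -> O p ->
  exists V W, [/\ open V, open W, V p.1, W p.2 & V `*` W `<=` O].
Proof.
move=> oO Op; have [[A B] /= [nA nB] ABO] : nbhs p O by exact: open_nbhs_nbhs.
move: nA nB; rewrite !nbhsE => -[V [oV Vp] VA] [W [oW Wp] WB].
exists V, W; split=> // -[a b] [/= Va Wb]; apply: ABO.
by split; [exact: VA|exact: WB].
Qed.

Lemma continuous_fst (X Y : topologicalType) : continuous (@fst X Y).
Proof. by move=> p; exact: cvg_fst. Qed.

Lemma continuous_snd (X Y : topologicalType) : continuous (@snd X Y).
Proof. by move=> p; exact: cvg_snd. Qed.

Lemma kolmogorov_prod (X Y : topologicalType) :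
  kolmogorov_space X -> kolmogorov_space Y -> kolmogorov_space (X * Y)%type.
Proof.
have pull (Z T : topologicalType) (f : Z -> T) (p q : Z) :
    continuous f -> kolmogorov_space T -> f p != f q ->
    exists A, (A \in nbhs p /\ q \in ~` A) \/ (A \in nbhs q /\ p \in ~` A).
  move=> cf kT /kT[A]; rewrite !in_setE => hA; exists (f @^-1` A).
  rewrite !in_setE; case: hA => -[nA ?]; [left|right]; split=> //;
    exact: cf nA.
move=> kX kY p q pq.
have [e1|ne1] := eqVneq p.1 q.1; last exact: pull (@continuous_fst X Y) kX ne1.
have [e2|ne2] := eqVneq p.2 q.2; last exact: pull (@continuous_snd X Y) kY ne2.
by move/negP: pq; case; rewrite -pair_eqE /pair_eq e1 e2 !eqxx.
Qed.

Theorem proposition1 (X Y : topologicalType) :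
  well_filtered X -> well_filtered Y -> well_filtered (X * Y)%type.
Proof.
move=> wfX wfY; split; first exact: kolmogorov_prod wfX.1 wfY.1.
move=> U F oU filtF FU; apply: contrapT => noK.
have [_ Fsc Fdir] := filtF.
have [|||M [oM UM FM maxM]] := @exists_maximal_open _ F U.
- by move=> K /Fsc[].
- exact: oU.
- by move=> K FK KU; apply: noK; exists K.
have [x xP] := well_filtered_generic_point (@continuous_fst X Y) wfX filtF
  oM FM maxM.
have [y yP] := well_filtered_generic_point (@continuous_snd X Y) wfY filtF
  oM FM maxM.
have Fxy : (\bigcap_(K in F) K) (x, y).
  move=> K FK; rewrite (Fsc K FK).1 => O [oO KO].
  have [p Kp nMp] : exists2 p, K p & ~ M p.
    apply: contrapT => h; apply: (FM K FK) => p Kp.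
    by apply: contrapT => nMp; apply: h; exists p.
  have [V [W [oV oW Vp Wp VWO]]] := open_box oO (KO p Kp).
  apply: VWO; split=> /=.
  - by apply/xP => // VM; apply/nMp/VM.
  - by apply/yP => // WM; apply/nMp/WM.
have [V [W [oV oW Vx Wy VWM]]] := open_box oM (UM _ (FU _ Fxy)).
have [K1 FK1 K1V] :=
  maxM _ ((continuousP _).1 (@continuous_fst X Y) V oV) ((xP V oV).1 Vx).
have [K2 FK2 K2W] :=
  maxM _ ((continuousP _).1 (@continuous_snd X Y) W oW) ((yP W oW).1 Wy).
have [K3 FK3 K312] := Fdir _ _ FK1 FK2.
apply: (FM K3 FK3) => p /K312[/K1V[//|Vp] /K2W[//|Wp]].
by apply: VWM; split.
Qed.
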